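(* Let $V$ be an $m\times n$ $(0,1)$-matrix and $B$ a $p\times q$ $(0,1)$-matrix, let $L=\begin{bmatrix}0 & V\\ V^T & 0\end{bmatrix}$, $H=\begin{bmatrix}0 & B\\ B^T & 0\end{bmatrix}$, $H^{\#}=\begin{bmatrix}0 & B^T\\ B & 0\end{bmatrix}$, and suppose the bipartite graphs $G_L$ and $G_H$ have no isolated vertices. If $G_L$ and $G_H$ are connected, then $G_L$ and $G_H$ have property $\eta$.
   Context: For a symmetric $(0,1)$-matrix $A$ with zero diagonal, $G_A$ is the simple graph with adjacency matrix $A$; so $G_L$ (resp. $G_H$) is the bipartite graph with biadjacency matrix $V$ (resp. $B$). The partitioned tensor product of $2\times 2$ block matrices is $\begin{bmatrix}U & V'\\ W & X\end{bmatrix}\underline{\otimes}\begin{bmatrix}A & B'\\ C & D\end{bmatrix}=\begin{bmatrix}U\otimes A & V'\otimes B'\\ W\otimes C & X\otimes D\end{bmatrix}$ ($\otimes$ the Kronecker product), so $L\underline{\otimes}H=\begin{bmatrix}0 & V\otimes B\\ V^T\otimes B^T & 0\end{bmatrix}$ and $L\underline{\otimes}H^{\#}=\begin{bmatrix}0 & V\otimes B^T\\ V^T\otimes B & 0\end{bmatrix}$. The canonical bipartition of $G_{L\underline{\otimes}H}$ is $X_1\cup Y_1$, with $X_1$ the first $mp$ vertices (rows of $V\otimes B$) and $Y_1$ the last $nq$ vertices; that of $G_{L\underline{\otimes}H^{\#}}$ is $X_2\cup Y_2$, with $X_2$ the first $mq$ vertices (rows of $V\otimes B^T$) and $Y_2$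 the last $np$ vertices. An isomorphism $f$ from $G_{L\underline{\otimes}H}$ to $G_{L\underline{\otimes}H^{\#}}$ respects the partite sets if either $f(X_1)=X_2,f(Y_1)=Y_2$ or $f(X_1)=Y_2,f(Y_1)=X_2$. The graphs $G_L$ and $G_H$ have property $\eta$ if, whenever $G_{L\underline{\otimes}H}$ and $G_{L\underline{\otimes}H^{\#}}$ are isomorphic, there exists an isomorphism between them that respects the partite sets of the canonical bipartitions. *)

(* Defs.v *)
From mathcomp Require Import all_boot all_algebra.
From mathcomp Require Export mxtens.

Set Implicit Arguments.
Unset Strict Implicit.
Unset Printing Implicit Defensive.

Import GRing.Theory.
Local Open Scope ring_scope.

Section Matrices.
Variable R : nzRingType.

Definition zero_one_mx m n (A : 'M[R]_(m, n)) : Prop :=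
  forall i j, A i j = 0 \/ A i j = 1.

Definition bip_mx m n (V : 'M[R]_(m, n)) : 'M[R]_(m + n) :=
  block_mx 0 V V^T 0.

Definition bip_sharp_mx p q (B : 'M[R]_(p, q)) : 'M[R]_(q + p) :=
  block_mx 0 B^T B 0.

Definition ptens_mx m1 m2 n1 n2 p1 p2 q1 q2
    (M : 'M[R]_(m1 + m2, n1 + n2)) (N : 'M[R]_(p1 + p2, q1 + q2)) :
    'M[R]_(m1 * p1 + m2 * p2, n1 * q1 + n2 * q2) :=
  block_mx (ulsubmx M *t ulsubmx N) (ursubmx M *t ursubmx N)
           (dlsubmx M *t dlsubmx N) (drsubmx M *t drsubmx N).

Lemma ptens_bip_mx m n p q (V : 'M[R]_(m, n)) (B : 'M[R]_(p, q)) :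
  ptens_mx (bip_mx V) (bip_mx B) = block_mx 0 (V *t B) (V^T *t B^T) 0.
Proof.
by rewrite /ptens_mx !block_mxKul !block_mxKur !block_mxKdl !block_mxKdr !tens0mx.
Qed.

Lemma ptens_bip_sharp_mx m n p q (V : 'M[R]_(m, n)) (B : 'M[R]_(p, q)) :
  ptens_mx (bip_mx V) (bip_sharp_mx B) = block_mx 0 (V *t B^T) (V^T *t B) 0.
Proof.
by rewrite /ptens_mx !block_mxKul !block_mxKur !block_mxKdl !block_mxKdr !tens0mx.
Qed.

(* The graph G_A, as an adjacency relation on row/column indices.  It is a
   simple graph when A is symmetric with zero diagonal: see [mx_graph_sym] and
   [mx_graph_irr]. *)
Definition mx_graph N (A : 'M[R]_N) : rel 'I_N := fun i j => A i j == 1.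

Lemma mx_graph_sym N (A : 'M[R]_N) : A^T = A -> symmetric (mx_graph A).
Proof. by move=> AT i j; rewrite /mx_graph -{1}AT mxE. Qed.

Lemma mx_graph_irr N (A : 'M[R]_N) :
  (forall i, A i i = 0) -> irreflexive (mx_graph A).
Proof. by move=> A0 i; rewrite /mx_graph A0 eq_sym oner_eq0. Qed.

End Matrices.

Definition no_isolated (T : finType) (e : rel T) : Prop :=
  forall x, exists y, e x y.

Definition connected_graph (T : finType) (e : rel T) : Prop :=
  forall x y, connect e x y.

Definition graph_iso (T1 T2 : finType) (e1 : rel T1) (e2 : rel T2)
    (f : T1 -> T2) : Prop :=
  bijective f /\ forall x y, e2 (f x) (f y) = e1 x y.

Definition first_part a b : {set 'I_(a + b)} := [set lshift b i | i : 'I_a].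
Definition last_part a b : {set 'I_(a + b)} := [set rshift a j | j : 'I_b].

Definition respects_parts a1 b1 a2 b2 (f : 'I_(a1 + b1) -> 'I_(a2 + b2)) : Prop :=
  (f @: first_part a1 b1 = first_part a2 b2 /\
   f @: last_part a1 b1 = last_part a2 b2)
  \/
  (f @: first_part a1 b1 = last_part a2 b2 /\
   f @: last_part a1 b1 = first_part a2 b2).

(* Property eta depends on the ordered bipartitions, hence it is stated on the
   biadjacency matrices V and B of the two bipartite graphs. *)
Definition property_eta (R : nzRingType) m n p q
    (V : 'M[R]_(m, n)) (B : 'M[R]_(p, q)) : Prop :=
  let G1 := mx_graph (ptens_mx (bip_mx V) (bip_mx B)) in
  let G2 := mx_graph (ptens_mx (bip_mx V) (bip_sharp_mx B)) in
  (exists f, graph_iso G1 G2 f) ->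
  exists f, graph_iso G1 G2 f /\ respects_parts f.

(* Main.v *)
Require Import Defs.
From mathcomp Require Import all_boot all_algebra.

(** A connected graph has at most one bipartition up to exchanging its two
    parts, and both graphs are bipartite for their canonical partitions, so it
    suffices that the first graph is connected: then every isomorphism respects
    the parts.  For each edge [k ~ l] of [G_H], the map sending a row vertex [i]
    of [G_L] to [(i, k)] and a column vertex [j] to [(j, l)] is a homomorphism
    from [G_L] to the product, and symmetrically for each edge of [G_L].  As
    every vertex lies on an edge, any two vertices of the product are joined by
    a walk that changes first one coordinate and then the other. *)

Set Implicit Arguments.
Unset Strict Implicit.
Unset Printing Implicit Defensive.

Import GRing.Theory.
Local Open Scope ring_scope.

Lemma connect_homo (T1 T2 : finType) (e1 : rel T1) (e2 : rel T2) (f : T1 -> T2) :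
  {homo f : x y / e1 x y >-> e2 x y} ->
  {homo f : x y / connect e1 x y >-> connect e2 x y}.
Proof.
move=> fP x y /connectP [s s_path ->]; apply/connectP; exists (map f s).
  by rewrite path_map; apply: sub_path s_path => u v /fP.
by rewrite last_map.
Qed.

(** A bipartition, encoded by the indicator of one of its parts. *)
Definition two_coloring (T : finType) (e : rel T) (c : pred T) : Prop :=
  forall x y, e x y -> c y = ~~ c x.

(** Crossing an edge flips both colors, so whether [c] and [d] agree is unchanged along edges, hence
    constant on a connected graph. *)
Lemma connected_two_coloring (T : finType) (e : rel T) (c d : pred T) :
    connected_graph e -> two_coloring e c -> two_coloring e d ->
  c =1 d \/ c =1 predC d.
Proof.
move=> e_conn cP dP.
have cd_const x y : (c x == d x) = (c y == d y).
  have cd_closed : closed e [pred z | c z == d z].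
    by move=> u v uv; rewrite !inE (cP _ _ uv) (dP _ _ uv) (inj_eq negb_inj).
  exact: (closed_connect cd_closed (e_conn x y)).
have [x cdx|cdF] := pickP [pred x | c x == d x].
  by left=> y; apply/eqP; rewrite -(cd_const x).
by right=> x; move: (cdF x) => /=; case: (c x); case: (d x).
Qed.

Lemma lshift_first_part a b (i : 'I_a) : lshift b i \in first_part a b.
Proof. exact: imset_f. Qed.

Lemma rshift_first_part a b (j : 'I_b) : (rshift a j \in first_part a b) = false.
Proof. by apply/imsetP => -[i _ /eqP]; rewrite eq_rlshift. Qed.

Lemma last_partE a b : last_part a b = ~: first_part a b.
Proof.
apply/setP=> x; rewrite inE; case: (split_ordP x) => i ->.
  rewrite lshift_first_part; apply/imsetP => -[j _ /eqP].
  by rewrite eq_lrshift.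
by rewrite rshift_first_part imset_f.
Qed.

Lemma respects_partsP a1 b1 a2 b2 (f : 'I_(a1 + b1) -> 'I_(a2 + b2)) :
    bijective f ->
    (forall x, (f x \in first_part a2 b2) = (x \in first_part a1 b1)) \/
    (forall x, (f x \in first_part a2 b2) = (x \notin first_part a1 b1)) ->
  respects_parts f.
Proof.
case=> g fK gK; rewrite /respects_parts !last_partE.
(* The image under [f] is the preimage under [g]; writing [y] as [f (g y)] then lets [fP] decide
   membership. *)
by case=> fP; [left|right]; split; apply/setP => y;
  rewrite (can2_imset_pre _ fK gK) !inE -{2}[y]gK fP ?negbK.
Qed.

Section BlockGraph.
Variable R : nzRingType.

(** The zero diagonal blocks forbid edges inside a part, since [1 != 0] in [R]. *)
Lemma block_graph_two_coloring a b (U : 'M[R]_(a, b)) (W : 'M[R]_(b, a)) :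
  two_coloring (mx_graph (block_mx 0 U W 0)) (mem (first_part a b)).
Proof.
move=> x y /=; rewrite /mx_graph.
case: (split_ordP x) => i ->; case: (split_ordP y) => j ->;
  rewrite ?lshift_first_part ?rshift_first_part //.
  by rewrite block_mxEul mxE eq_sym oner_eq0.
by rewrite block_mxEdr mxE eq_sym oner_eq0.
Qed.

Variables (m n : nat) (V : 'M[R]_(m, n)).

Lemma bip_edge_lr i j :
  mx_graph (bip_mx V) (lshift n i) (rshift m j) = (V i j == 1).
Proof. by rewrite /mx_graph block_mxEur. Qed.

Lemma bip_edge_rl i j :
  mx_graph (bip_mx V) (rshift m j) (lshift n i) = (V i j == 1).
Proof. by rewrite /mx_graph block_mxEdl mxE. Qed.

Lemma no_isolated_row i :
  no_isolated (mx_graph (bip_mx V)) -> exists j, V i j = 1.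
Proof.
move=> /(_ (lshift n i)) [y]; case: (split_ordP y) => j ->.
  by rewrite /mx_graph block_mxEul mxE eq_sym oner_eq0.
by rewrite bip_edge_lr => /eqP; exists j.
Qed.

Lemma no_isolated_col j :
  no_isolated (mx_graph (bip_mx V)) -> exists i, V i j = 1.
Proof.
move=> /(_ (rshift m j)) [y]; case: (split_ordP y) => i ->.
  by rewrite bip_edge_rl => /eqP; exists i.
by rewrite /mx_graph block_mxEdr mxE eq_sym oner_eq0.
Qed.

(** Both orientations are requested because [e] is an arbitrary relation, while an edge of the
    source may be read from either end. *)
Lemma bip_homo (T : finType) (e : rel T) (f : 'I_m -> T) (g : 'I_n -> T) :
    (forall i j, V i j = 1 -> e (f i) (g j) /\ e (g j) (f i)) ->
  {homo (fun x => match split x with inl i => f i | inr j => g j end) :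
    x y / mx_graph (bip_mx V) x y >-> e x y}.
Proof.
move=> efg x y.
case: (split_ordP x) => i ->; case: (split_ordP y) => j ->.
- by rewrite /mx_graph block_mxEul mxE eq_sym oner_eq0.
- by rewrite bip_edge_lr => /eqP /efg [].
- by rewrite bip_edge_rl => /eqP /efg [].
- by rewrite /mx_graph block_mxEdr mxE eq_sym oner_eq0.
Qed.

(* [f] and [g] are the two halves of a graph homomorphism out of [G_V]. *)
Lemma connect_bip (T : finType) (e : rel T) (f : 'I_m -> T) (g : 'I_n -> T) :
    connected_graph (mx_graph (bip_mx V)) ->
    (forall i j, V i j = 1 -> e (f i) (g j) /\ e (g j) (f i)) ->
  [/\ forall i i', connect e (f i) (f i'), forall i j, connect e (f i) (g j),
      forall i j, connect e (g j) (f i) & forall j j', connect e (g j) (g j')].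
Proof.
move=> V_conn /bip_homo /connect_homo fgP.
have splitl i : split (lshift n i) = inl i :> 'I_m + 'I_n := unsplitK (inl i).
have splitr j : split (rshift m j) = inr j :> 'I_m + 'I_n := unsplitK (inr j).
split=> [i i'|i j|i j|j j'].
- by have := fgP _ _ (V_conn (lshift n i) (lshift n i')); rewrite !splitl.
- by have := fgP _ _ (V_conn (lshift n i) (rshift m j)); rewrite splitl splitr.
- by have := fgP _ _ (V_conn (rshift m j) (lshift n i)); rewrite splitl splitr.
- by have := fgP _ _ (V_conn (rshift m j) (rshift m j')); rewrite !splitr.
Qed.

End BlockGraph.

Lemma ptens_bip_connected (R : nzRingType) m n p q
    (V : 'M[R]_(m, n)) (B : 'M[R]_(p, q)) :
    no_isolated (mx_graph (bip_mx V)) -> no_isolated (mx_graph (bip_mx B)) ->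
    connected_graph (mx_graph (bip_mx V)) ->
    connected_graph (mx_graph (bip_mx B)) ->
  connected_graph (mx_graph (ptens_mx (bip_mx V) (bip_mx B))).
Proof.
move=> V_noiso B_noiso V_conn B_conn; rewrite ptens_bip_mx.
set e := mx_graph _.
(* A product vertex pairs two rows ([f]) or two columns ([g]), never a row with a column. *)
pose f i k := lshift (n * q) (mxtens_index (i, k) : 'I_(m * p)).
pose g j l := rshift (m * p) (mxtens_index (j, l) : 'I_(n * q)).
have efg i j k l : V i j = 1 -> B k l = 1 ->
    e (f i k) (g j l) /\ e (g j l) (f i k).
  move=> Vij Bkl; rewrite /e /mx_graph block_mxEur block_mxEdl !tensmxE !mxE.
  by rewrite Vij Bkl mulr1 eqxx.
(* Walks over [G_V] with the second coordinate alternating between [k] and [l]; [walkB] exchanges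
   the roles. *)
have walkV k l (Bkl : B k l = 1) :=
  connect_bip V_conn (fun i j Vij => efg i j k l Vij Bkl).
have walkB i j (Vij : V i j = 1) :=
  connect_bip B_conn (fun k l => efg i j k l Vij).
move=> x y.
case: (split_ordP x) => x' ->; case: (mxtens_indexP x') => i k;
  case: (split_ordP y) => y' ->; case: (mxtens_indexP y') => i' k'.
(* From [(i, k)] to [(i', k)] over the edge [k ~ l], then to [(i', k')] over the edge [i' ~ j]. *)
- have [l Bkl] := no_isolated_row k B_noiso.
  have [j Vij] := no_isolated_row i' V_noiso.
  have [ff _ _ _] := walkV _ _ Bkl; have [ff' _ _ _] := walkB _ _ Vij.
  exact: connect_trans (ff i i') (ff' k k').
(* Here [i'] is a column, so the first walk changes sides and ends at [(i', l)]. *)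
- have [l Bkl] := no_isolated_row k B_noiso.
  have [j Vij] := no_isolated_col i' V_noiso.
  have [_ fg _ _] := walkV _ _ Bkl; have [_ _ _ gg] := walkB _ _ Vij.
  exact: connect_trans (fg i i') (gg l k').
- have [l Bkl] := no_isolated_col k B_noiso.
  have [j Vij] := no_isolated_row i' V_noiso.
  have [_ _ gf _] := walkV _ _ Bkl; have [ff _ _ _] := walkB _ _ Vij.
  exact: connect_trans (gf i' i) (ff l k').
- have [l Bkl] := no_isolated_col k B_noiso.
  have [j Vij] := no_isolated_col i' V_noiso.
  have [_ _ _ gg] := walkV _ _ Bkl; have [_ _ _ gg'] := walkB _ _ Vij.
  exact: connect_trans (gg i i') (gg' k k').
Qed.

Theorem theorem4p4 (R : nzRingType) (m n p q : nat)
    (V : 'M[R]_(m, n)) (B : 'M[R]_(p, q))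
    (V01 : zero_one_mx V) (B01 : zero_one_mx B)
    (L_noiso : no_isolated (mx_graph (bip_mx V)))
    (H_noiso : no_isolated (mx_graph (bip_mx B)))
    (L_conn : connected_graph (mx_graph (bip_mx V)))
    (H_conn : connected_graph (mx_graph (bip_mx B))) :
  property_eta V B.
Proof.
move=> /= [f [f_bij f_iso]]; exists f; split=> //; apply: respects_partsP => //.
apply: (connected_two_coloring
          (ptens_bip_connected L_noiso H_noiso L_conn H_conn)).
  (* The canonical coloring of the second graph, pulled back along [f], colors the first because [f]
     preserves edges. *)
  move=> x y; rewrite -f_iso ptens_bip_sharp_mx.
  exact: block_graph_two_coloring.
by rewrite ptens_bip_mx; exact: block_graph_two_coloring.
Qed.
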